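(* Let $\mu$ be a nontrivial probability measure on the real line with finite moments of all nonnegative orders, let $\alpha_1,\dots,\alpha_M$ be distinct real numbers, $M_1,\dots,M_M$ nonnegative integers, and $\lambda_{i,j}$ ($1\le i\le M$, $0\le j\le M_i$) real numbers. Consider the discrete Sobolev inner product $$\langle f,g\rangle=\int f(t)g(t)\,d\mu(t)+\sum_{i=1}^{M}\sum_{j=0}^{M_i}\lambda_{i,j}f^{(j)}(\alpha_i)g^{(j)}(\alpha_i)$$ on real polynomials, and put $h(t)=\prod_{i=1}^{M}(t-\alpha_i)^{M_i+1}$, $N=\deg h$, $d\mu_0=h\,d\mu$. Assume that both $\langle\cdot,\cdot\rangle$ and $(f,g)_0=\int fg\,d\mu_0$ are quasi-definite, with sequences of monic orthogonal polynomials $\{P_n^*\}_{n\ge0}$ and $\{P_n\}_{n\ge0}$, respectively. Let $J_{mon}$ be the monic Jacobi matrix associated with $d\mu_0$, and let $J_{mon}^*$ be the band matrix generated by the recurrence relations for $\{P_n^*\}_{n\ge 0}$. Then $J_{mon}^*$ is obtained from $J_{mon}$ as $$h(J_{mon})=U_{mon}L_{mon}\ \mapsto\ J_{mon}^*=L_{mon}U_{mon},$$ that is, both equalities hold, where $L_{mon}$ is the lower triangular band matrix and $U_{mon}$ the upper triangular band matrix determined by $P^*=L_{mon}P$ and $hP=U_{mon}P^*$, with $P=(P_0,P_1,\dots)^T$, $P^*=(P_0^*,P_1^*,\dots)^T$.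
   Context: A measure is nontrivial if its support is infinite. A symmetric bilinear form $B$ on real polynomials is quasi-definite if all leading principal submatrices of its Gram matrix $(B(t^i,t^j))_{i,j\ge0}$ are nonsingular; then it has a unique sequence of monic orthogonal polynomials, one of each degree $n \geq 0$. Monic Jacobi matrix: the polynomials $P_n$ satisfy a three-term recurrence $tP_n(t)=P_{n+1}(t)+D_nP_n(t)+C_nP_{n-1}(t)$ with $C_n\ne0$ for $n\ge 1$ ($P_{-1}=0$), and $J_{mon}$ is the semi-infinite tridiagonal matrix with $tP=J_{mon}P$ (diagonal $D_n$, superdiagonal $1$, subdiagonal $C_n$). For a polynomial $h(t)=\sum_{m=0}^N b_mt^m$, $h(J_{mon})=\sum_{m=0}^N b_mJ_{mon}^m$. Band matrix: since multiplication by $h$ is symmetric for $\langle\cdot,\cdot\rangle$, the polynomials $P_n^*$ satisfy $h(t)P_n^*(t)=\sum_{k=\max(0,n-N)}^{n+N}c_k^{[n]}P_k^*(t)$ with $c_{n+N}^{[n]}=1$; $J^*_{mon}$ is the semi-infinite $(2N+1)$-band matrix with entries $c^{[n]}_k$ in row $n$, column $k$, so $hP^*=J_{mon}^*P^*$. Connection matrices: $P_n^*=P_n+A_{n-1}^{[n]}P_{n-1}+\dots+A_{n-N}^{[n]}P_{n-N}$ (with $P_j=0$ for $j<0$), and $L_{mon}$ is the unit lower triangular matrix with entry $A_k^{[n]}$ in row $n$, column $k$ ($\max(0,n-N)\le k<n$), $1$ on the diagonal and $0$ elsewhere. Also $hP_n=\sum_{i=n}^{n+N}B_i^{[n+N]}P_i^*$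 with $B_{n+N}^{[n+N]}=1$, and $U_{mon}$ is the upper triangular matrix with entry $B_i^{[n+N]}$ in row $n$, column $i$ ($n\le i\le n+N$), and $0$ elsewhere. *)

(* Defs.v *)
From mathcomp Require Import all_boot all_order all_algebra.
From mathcomp Require Import all_classical all_reals all_analysis.

Set Implicit Arguments.
Unset Strict Implicit.
Unset Printing Implicit Defensive.

Import Order.TTheory GRing.Theory Num.Theory.
Import numFieldNormedType.Exports.

Local Open Scope classical_set_scope.
Local Open Scope ring_scope.

Definition msupport (R : realType)
    (mu : {measure set (measurableTypeR R) -> \bar R}) : set R :=
  [set x : R | forall V : set R, open V -> V x -> (0 < mu V)%E].

Definition nontrivial_measure (R : realType)
    (mu : {measure set (measurableTypeR R) -> \bar R}) : Prop :=
  infinite_set (msupport mu).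

Definition finite_moments (R : realType)
    (mu : {measure set (measurableTypeR R) -> \bar R}) : Prop :=
  forall n : nat, mu.-integrable setT (fun t : R => (t ^+ n)%:E).

(* (f, g) |-> \int f g h dmu, the form of the (signed) measure h dmu. *)
Definition weighted_form (R : realType)
    (mu : {measure set (measurableTypeR R) -> \bar R}) (h f g : {poly R}) : R :=
  Rintegral mu setT (fun t : R => f.[t] * g.[t] * h.[t]).

(* [m i] is the highest derivative at the node [alpha i]; only the values
   [lambda i j] with [j <= m i] are used. *)
Definition sobolev_form (R : realType)
    (mu : {measure set (measurableTypeR R) -> \bar R}) (M : nat)
    (alpha : 'I_M -> R) (m : 'I_M -> nat) (lambda : 'I_M -> nat -> R)
    (f g : {poly R}) : R :=
  Rintegral mu setT (fun t : R => f.[t] * g.[t]) +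
  \sum_(i < M) \sum_(j < (m i).+1)
     lambda i j * (f^`(j)).[alpha i] * (g^`(j)).[alpha i].

Definition node_poly (R : realType) (M : nat)
    (alpha : 'I_M -> R) (m : 'I_M -> nat) : {poly R} :=
  \prod_(i < M) ('X - (alpha i)%:P) ^+ (m i).+1.

Definition quasi_definite (R : realType)
    (B : {poly R} -> {poly R} -> R) : Prop :=
  forall n : nat, \matrix_(i < n, j < n) B 'X^i 'X^j \in unitmx.

Definition monic_orthogonal (R : realType)
    (B : {poly R} -> {poly R} -> R) (P : nat -> {poly R}) : Prop :=
  [/\ forall n, P n \is monic,
      forall n, size (P n) = n.+1
    & forall k n, k != n -> B (P k) (P n) = 0].

Definition smatrix (R : realType) := nat -> nat -> R.

Definition smx1 (R : realType) : smatrix R := fun i j => (i == j)%:R.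

(* The finitely supported sum is the usual product whenever the rows of A or
   the columns of B are finitely supported, as for all matrices used here. *)
Definition smulmx (R : realType) (A B : smatrix R) : smatrix R :=
  fun i j => \sum_(k \in [set: nat]) A i k * B k j.

Definition sexpmx (R : realType) (A : smatrix R) (n : nat) : smatrix R :=
  iter n (smulmx A) (smx1 R).

Definition shornermx (R : realType) (h : {poly R}) (A : smatrix R)
  : smatrix R :=
  fun i j => \sum_(n < size h) h`_n * sexpmx A n i j.

Definition tridiag (R : realType) (C D : nat -> R) : smatrix R :=
  fun n k => if k == n then D n
             else if k == n.+1 then 1
             else if k.+1 == n then C n
             else 0.

Definition is_monic_jacobi (R : realType) (P : nat -> {poly R})
    (J : smatrix R) : Prop :=
  exists C D : nat -> R,
    [/\ forall n, (0 < n)%N -> C n != 0,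
        forall n, 'X * P n = P n.+1 + D n *: P n
                             + C n *: (if n is k.+1 then P k else 0)
      & J = tridiag C D].

(* In the three predicates below the truncated subtraction [n - N] is
   max(0, n - N), and [N] is the degree of [h]. *)

Definition is_recurrence_band (R : realType) (h : {poly R}) (N : nat)
    (Ps : nat -> {poly R}) (Js : smatrix R) : Prop :=
  [/\ forall n, h * Ps n = \sum_(n - N <= k < (n + N).+1) Js n k *: Ps k,
      forall n, Js n (n + N)%N = 1
    & forall n k, ~~ (n - N <= k <= n + N)%N -> Js n k = 0].

Definition is_lower_connection (R : realType) (N : nat)
    (P Ps : nat -> {poly R}) (L : smatrix R) : Prop :=
  [/\ forall n, Ps n = P n + \sum_(n - N <= k < n) L n k *: P k,
      forall n, L n n = 1
    & forall n k, ~~ (n - N <= k <= n)%N -> L n k = 0].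

Definition is_upper_connection (R : realType) (h : {poly R}) (N : nat)
    (P Ps : nat -> {poly R}) (U : smatrix R) : Prop :=
  [/\ forall n, h * P n = \sum_(n <= i < (n + N).+1) U n i *: Ps i,
      forall n, U n (n + N)%N = 1
    & forall n i, ~~ (n <= i <= n + N)%N -> U n i = 0].

(* Main.v *)
Require Import Defs.
From mathcomp Require Import all_boot all_order all_algebra.
From mathcomp Require Import all_classical all_reals all_analysis.
From mathcomp Require Import zify.

(** Every matrix of the theorem records the coefficients of one sequence of
polynomials in another: read A as an equation F = A Q between columns of
polynomials.  Three facts give the factorization.  Such an A is unique when Q
has one monic polynomial of each degree ([represents_inj]); the product of
matrices composes such equations ([represents_mul]); and h(J) records h P in
P as soon as J records t P in P ([represents_hornermx]).  Hence
U L P = U P* = h P = h(J) P gives h(J) = U L, while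
L U P* = L h P = h L P = h P* = J* P* gives J* = L U
([band_factorization]).

Orthogonality is what makes the four matrices exist with the prescribed band
shapes.  The Sobolev form and the form of h dmu are tied by
<h f, g> = (f, g)_0, because h vanishes at each node to an order beyond that of
every derivative in the discrete part ([sobolev_node_poly]); symmetry then makes
multiplication by h self-adjoint.  Quasi-definiteness gives <Q_k, Q_k> <> 0
([norm_neq0]), so a polynomial f has in an orthogonal sequence Q the
coefficients <f, Q_k> / <Q_k, Q_k>.  They vanish above the degree of f, and they
vanish below some index by moving the factor t or h to the other argument and
comparing degrees ([fourier_band]). *)

Set Implicit Arguments.
Unset Strict Implicit.
Unset Printing Implicit Defensive.

Import Order.TTheory GRing.Theory Num.Theory.

Local Open Scope ring_scope.

(** * Matrix equations between sequences of polynomials *)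

Lemma sum_widen (V : nmodType) (G : nat -> V) (b d : nat) :
  (forall k, (b <= k)%N -> G k = 0) -> (b <= d)%N ->
  \sum_(0 <= k < d) G k = \sum_(0 <= k < b) G k.
Proof.
move=> G0 le_bd; rewrite (big_cat_nat (n := b)) //= [X in _ + X]big_nat_cond.
by rewrite [X in _ + X]big1 ?addr0 // => k /andP[/andP[le_bk _] _]; exact: G0.
Qed.

Lemma sum_from0 (V : nmodType) (G : nat -> V) (l u : nat) :
  (forall k, (k < l)%N -> G k = 0) ->
  \sum_(l <= k < u) G k = \sum_(0 <= k < u) G k.
Proof.
move=> G0; rewrite (big_nat_widenl _ 0) // [LHS]big_mkcond.
by apply: eq_bigr => k _ /=; case: leqP => // /G0 ->.
Qed.

(** The finitely supported sum is junk for infinite supports, so a bound on the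
support of row n of the left factor is what turns it into an ordinary sum. *)
Lemma smulmxE (R : realType) (A C : smatrix R) (n j b : nat) :
  (forall k, (b <= k)%N -> A n k = 0) ->
  smulmx A C n j = \sum_(0 <= k < b) A n k * C k j.
Proof.
move=> A0; rewrite big_mkord (@fsbig_ord _ _ +%R b (fun k => A n k * C k j)).
apply: esym; apply: fsbig_widen => // k [_ /= /negP]; rewrite -leqNgt => le_bk.
by rewrite A0 ?mul0r.
Qed.

(** The bound b is existential, so that one notion covers band, triangular and
product matrices alike. *)
Definition is_expansion (R : realType) (Q : nat -> {poly R}) (c : nat -> R)
    (f : {poly R}) : Prop :=
  exists2 b, (forall k, (b <= k)%N -> c k = 0)
           & f = \sum_(0 <= k < b) c k *: Q k.

(** The equation F = A Q between columns of polynomials. *)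
Definition represents (R : realType) (A : smatrix R) (F Q : nat -> {poly R})
    : Prop :=
  forall n, is_expansion Q (A n) (F n).

Lemma expansion_of_band (R : realType) (Q : nat -> {poly R}) (c : nat -> R)
    (f : {poly R}) (l u : nat) :
  f = \sum_(l <= k < u) c k *: Q k ->
  (forall k, ~~ (l <= k < u)%N -> c k = 0) -> is_expansion Q c f.
Proof.
move=> -> c0; exists u => [k le_uk|]; first by rewrite c0 // ltnNge le_uk andbF.
by apply: sum_from0 => k lt_kl; rewrite c0 ?scale0r // leqNgt lt_kl.
Qed.

Lemma expansion_lin (R : realType) (Q : nat -> {poly R}) (a : R)
    (c1 c2 : nat -> R) (f1 f2 : {poly R}) :
  is_expansion Q c1 f1 -> is_expansion Q c2 f2 ->
  is_expansion Q (fun k => a * c1 k + c2 k) (a *: f1 + f2).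
Proof.
move=> [b1 z1 ->] [b2 z2 ->]; exists (maxn b1 b2) => [k|].
  by rewrite geq_max => /andP[/z1 -> /z2 ->]; rewrite mulr0 addr0.
rewrite -(@sum_widen _ _ b1 (maxn b1 b2)) ?leq_maxl//; last first.
  by move=> k /z1 ->; rewrite scale0r.
rewrite -(@sum_widen _ _ b2 (maxn b1 b2)) ?leq_maxr//; last first.
  by move=> k /z2 ->; rewrite scale0r.
rewrite scaler_sumr -big_split; apply: eq_bigr => k _ /=.
by rewrite scalerDl scalerA.
Qed.

Lemma expansion_sum (R : realType) (Q : nat -> {poly R}) (n : nat)
    (a : nat -> R) (c : nat -> nat -> R) (f : nat -> {poly R}) :
  (forall i, is_expansion Q (c i) (f i)) ->
  is_expansion Q (fun k => \sum_(0 <= i < n) a i * c i k)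
    (\sum_(0 <= i < n) a i *: f i).
Proof.
move=> cf; elim: n => [|n IHn].
  by exists 0%N => [k _|]; rewrite !big_nil.
have := expansion_lin (a n) (cf n) IHn; rewrite big_nat_recr //= addrC.
by congr is_expansion; apply/funext => k; rewrite big_nat_recr //= addrC.
Qed.

(** Associativity (A C) Q = A (C Q), legitimate because each row of A involves
finitely many of the polynomials G_k. *)
Lemma represents_mul (R : realType) (A C : smatrix R)
    (F G Q : nat -> {poly R}) :
  represents A F G -> represents C G Q -> represents (smulmx A C) F Q.
Proof.
move=> AF CG n; have [b A0 ->] := AF n.
have := expansion_sum b (A n) CG; congr is_expansion.
by apply/funext => j; rewrite (smulmxE _ _ A0).
Qed.

Lemma represents_mulpoly (R : realType) (A : smatrix R)
    (F Q : nat -> {poly R}) (p : {poly R}) :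
  represents A F Q -> represents A (fun n => p * F n) (fun k => p * Q k).
Proof.
move=> AF n; have [b A0 ->] := AF n; exists b => //.
by rewrite mulr_sumr; apply: eq_bigr => k _; rewrite scalerAr.
Qed.

(** The induction step reads
t^(d+1) Q = t^d (J Q) = J (t^d Q) = J (J^d Q): multiplication by a
polynomial commutes with the action of a scalar matrix. *)
Lemma represents_expmx (R : realType) (J : smatrix R) (Q : nat -> {poly R})
    (d : nat) :
  represents J (fun n => 'X * Q n) Q ->
  represents (sexpmx J d) (fun n => 'X^d * Q n) Q.
Proof.
move=> JQ; elim: d => [|d IHd].
  move=> n; exists n.+1 => [k lt_nk|]; first by rewrite /= /smx1 ltn_eqF.
  rewrite expr0 mul1r big_nat_recr //= /smx1 eqxx scale1r big_nat_cond big1.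
    by rewrite add0r.
  by move=> k /andP[/andP[_ lt_kn] _]; rewrite gtn_eqF ?scale0r.
have := represents_mul (represents_mulpoly 'X^d JQ) IHd.
by congr represents; apply/funext => n; rewrite mulrA -exprSr.
Qed.

Lemma represents_hornermx (R : realType) (J : smatrix R)
    (Q : nat -> {poly R}) (h : {poly R}) :
  represents J (fun n => 'X * Q n) Q ->
  represents (shornermx h J) (fun n => h * Q n) Q.
Proof.
move=> JQ n.
have := @expansion_sum _ Q (size h) (fun i => h`_i) _ _
          (fun d => represents_expmx d JQ n).
congr is_expansion; first by apply/funext => k; rewrite /shornermx big_mkord.
rewrite -[in RHS](coefK h) poly_def mulr_suml big_mkord.
by apply: eq_bigr => i _; rewrite scalerAl.
Qed.

(** * Simple sequences: one monic polynomial of each degree *)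

Definition simple_sequence (R : realType) (Q : nat -> {poly R}) : Prop :=
  (forall n, Q n \is monic) /\ (forall n, size (Q n) = n.+1).

Lemma size_combination (R : realType) (Q : nat -> {poly R}) (c : nat -> R)
    (d : nat) :
  simple_sequence Q -> (size (\sum_(0 <= k < d) c k *: Q k)%R <= d)%N.
Proof.
move=> [_ szQ]; rewrite big_mkord; apply: (leq_trans (size_sum _ _ _)).
apply/bigmax_leqP => k _; apply: leq_trans (size_scale_leq _ _) _.
by rewrite szQ.
Qed.

Lemma coef_simple (R : realType) (Q : nat -> {poly R}) (n : nat) :
  simple_sequence Q -> (Q n)`_n = 1.
Proof.
by move=> [/(_ n) /monicP + szQ]; rewrite lead_coefE szQ.
Qed.

(** The coefficient of degree d isolates the last term of the sum. *)
Lemma simple_sequence_free (R : realType) (Q : nat -> {poly R})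
    (c : nat -> R) (d : nat) :
  simple_sequence Q -> \sum_(0 <= k < d) c k *: Q k = 0 ->
  forall k, (k < d)%N -> c k = 0.
Proof.
move=> sQ; elim: d => // d IHd; rewrite big_nat_recr //= => sum0.
have cd0 : c d = 0.
  have /(congr1 (fun p : {poly R} => p`_d)) := sum0.
  rewrite coefD coefZ (coef_simple _ sQ) mulr1 coef0 nth_default ?add0r //.
  exact: size_combination.
move=> k; rewrite ltnS leq_eqVlt => /predU1P[-> //|]; apply: IHd.
by move: sum0; rewrite cd0 scale0r addr0.
Qed.

Lemma expansion_inj (R : realType) (Q : nat -> {poly R}) (c1 c2 : nat -> R)
    (f : {poly R}) :
  simple_sequence Q -> is_expansion Q c1 f -> is_expansion Q c2 f -> c1 = c2.
Proof.
move=> sQ e1 e2; apply/funext => k.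
have [b z0] := expansion_lin (-1) e1 e2.
rewrite scaleN1r addNr => /esym sum0.
apply/esym/eqP; rewrite -subr_eq0 addrC -mulN1r; apply/eqP.
by case: (ltnP k b) => [|/z0//]; exact: (simple_sequence_free sQ sum0).
Qed.

Lemma represents_inj (R : realType) (A1 A2 : smatrix R)
    (F Q : nat -> {poly R}) :
  simple_sequence Q -> represents A1 F Q -> represents A2 F Q -> A1 = A2.
Proof.
by move=> sQ e1 e2; apply/funext => n; exact: expansion_inj sQ (e1 n) (e2 n).
Qed.

(** Subtracting the right multiple of Q_n lowers the degree bound of f. *)
Lemma simple_sequence_span (R : realType) (Q : nat -> {poly R}) (n : nat)
    (f : {poly R}) :
  simple_sequence Q -> (size f <= n)%N ->
  exists c : nat -> R, f = \sum_(0 <= k < n) c k *: Q k.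
Proof.
move=> sQ; elim: n f => [f|n IHn f le_fn].
  by rewrite leqn0 size_poly_eq0 => /eqP ->; exists (fun=> 0); rewrite big_nil.
have [|c fE] := IHn (f - f`_n *: Q n).
  apply/leq_sizeP => j; rewrite leq_eqVlt => /predU1P[<-|lt_nj].
    by rewrite coefB coefZ (coef_simple _ sQ) mulr1 subrr.
  rewrite coefB coefZ (nth_default _ (leq_trans le_fn lt_nj)).
  by rewrite [(Q n)`_j]nth_default ?sQ.2 // mulr0 subr0.
exists (fun k => if k == n then f`_n else c k).
rewrite big_nat_recr //= eqxx -[LHS](subrK (f`_n *: Q n)); congr (_ + _).
by rewrite fE; apply: eq_big_nat => k /andP[_ lt_kn]; rewrite ltn_eqF.
Qed.

(** * Orthogonal expansions for a quasi-definite form *)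

Record symmetric_bilinear (R : realType) (B : {poly R} -> {poly R} -> R)
    : Prop := {
  form_sym : forall f g, B f g = B g f;
  form_linear : forall a f1 f2 g, B (a *: f1 + f2) g = a * B f1 g + B f2 g }.

Lemma form0 (R : realType) (B : {poly R} -> {poly R} -> R) (g : {poly R}) :
  symmetric_bilinear B -> B 0 g = 0.
Proof.
move=> sB; have := form_linear sB (-1) 0 0 g.
by rewrite scaler0 addr0 mulN1r addNr.
Qed.

Lemma form_sum (R : realType) (B : {poly R} -> {poly R} -> R) (d : nat)
    (c : nat -> R) (f : nat -> {poly R}) (g : {poly R}) :
  symmetric_bilinear B ->
  B (\sum_(0 <= k < d) c k *: f k) g = \sum_(0 <= k < d) c k * B (f k) g.
Proof.
move=> sB; elim: d => [|d IHd]; first by rewrite !big_nil form0.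
by rewrite !big_nat_recr //= addrC form_linear // IHd addrC.
Qed.

Lemma monic_orthogonal_simple (R : realType) (B : {poly R} -> {poly R} -> R)
    (Q : nat -> {poly R}) : monic_orthogonal B Q -> simple_sequence Q.
Proof. by case. Qed.

Lemma form_combination (R : realType) (B : {poly R} -> {poly R} -> R)
    (Q : nat -> {poly R}) (c : nat -> R) (d n : nat) :
  symmetric_bilinear B -> monic_orthogonal B Q ->
  B (\sum_(0 <= k < d) c k *: Q k) (Q n) =
    if (n < d)%N then c n * B (Q n) (Q n) else 0.
Proof.
move=> sB [_ _ oQ]; rewrite form_sum // big_mkord; case: ltnP => [lt_nd|le_dn].
  rewrite (bigD1 (Ordinal lt_nd)) //= big1 ?addr0 // => k ne_kn.
  by rewrite oQ ?mulr0.
by rewrite big1 // => k _; rewrite oQ ?mulr0 // ltn_eqF //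
  (leq_trans (ltn_ord k)).
Qed.

Lemma form_low_degree (R : realType) (B : {poly R} -> {poly R} -> R)
    (Q : nat -> {poly R}) (f : {poly R}) (n : nat) :
  symmetric_bilinear B -> monic_orthogonal B Q -> (size f <= n)%N ->
  B f (Q n) = 0.
Proof.
move=> sB oQ /(simple_sequence_span (monic_orthogonal_simple oQ))[c ->].
by rewrite form_combination // ltnn.
Qed.

(** If <Q_n, Q_n> vanished, then Q_n would be orthogonal to all polynomials of
degree at most n, and its coefficient vector would be a nonzero element of the
kernel of the Gram matrix of size n + 1. *)
Lemma norm_neq0 (R : realType) (B : {poly R} -> {poly R} -> R)
    (Q : nat -> {poly R}) (n : nat) :
  symmetric_bilinear B -> quasi_definite B -> monic_orthogonal B Q ->
  B (Q n) (Q n) != 0.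
Proof.
move=> sB qd oQ; have sQ := monic_orthogonal_simple oQ; apply/eqP => norm0.
have kerQ (j : 'I_n.+1) : B 'X^j (Q n) = 0.
  have [|c ->] := @simple_sequence_span _ _ n.+1 'X^j sQ.
    by rewrite size_polyXn ltn_ord.
  by rewrite form_combination // ltnSn norm0 mulr0.
(* Symmetry turns the product of v with the Gram matrix into the pairings of
   kerQ. *)
pose v : 'rV[R]_n.+1 := \row_i (Q n)`_i.
pose G : 'M[R]_n.+1 := \matrix_(i < n.+1, j < n.+1) B 'X^i 'X^j.
have v0 : v = 0.
  suff vG : v *m G = 0 by rewrite -[v](mulmxK (qd n.+1)) vG mul0mx.
  apply/rowP => j; rewrite !mxE -[RHS](kerQ j) (form_sym sB).
  have -> : Q n = \sum_(0 <= i < n.+1) (Q n)`_i *: 'X^i.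
    by rewrite -[LHS]coefK poly_def sQ.2 big_mkord.
  rewrite form_sum // big_mkord.
  by apply: eq_bigr => i _; rewrite !mxE.
have /rowP/(_ ord_max) := v0; rewrite !mxE /= (coef_simple _ sQ) => /eqP.
by rewrite oner_eq0.
Qed.

Definition fourier_coef (R : realType) (B : {poly R} -> {poly R} -> R)
    (Q : nat -> {poly R}) (f : {poly R}) (k : nat) : R :=
  B f (Q k) / B (Q k) (Q k).

(** The common source of the four band matrices: the degree of f bounds its
expansion from above, orthogonality to the first l polynomials bounds it from
below, and the leading coefficient fixes the top entry. *)
Lemma fourier_band (R : realType) (B : {poly R} -> {poly R} -> R)
    (Q : nat -> {poly R}) (f : {poly R}) (l u : nat) :
  symmetric_bilinear B -> quasi_definite B -> monic_orthogonal B Q ->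
  f \is monic -> size f = u.+1 -> (forall k, (k < l)%N -> B f (Q k) = 0) ->
  [/\ f = \sum_(l <= k < u.+1) fourier_coef B Q f k *: Q k,
      fourier_coef B Q f u = 1
    & forall k, ~~ (l <= k <= u)%N -> fourier_coef B Q f k = 0].
Proof.
move=> sB qd oQ mf szf f_low; have sQ := monic_orthogonal_simple oQ.
have [c fE] : exists c : nat -> R, f = \sum_(0 <= k < u.+1) c k *: Q k.
  by apply: simple_sequence_span; rewrite ?szf.
have cE k : (k <= u)%N -> fourier_coef B Q f k = c k.
  move=> le_ku; rewrite /fourier_coef {1}fE form_combination // ltnS le_ku.
  by rewrite mulfK // (norm_neq0 _ sB qd oQ).
have lowE k : (k < l)%N -> fourier_coef B Q f k = 0.
  by move=> /f_low fQ; rewrite /fourier_coef fQ mul0r.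
split.
- rewrite sum_from0 => [|k /lowE ->]; last by rewrite scale0r.
  by rewrite {1}fE; apply: eq_big_nat => k /andP[_ lt_ku]; rewrite cE.
- rewrite cE //.
  have /(congr1 (fun p : {poly R} => p`_u)) := fE.
  rewrite big_nat_recr //= coefD coefZ (coef_simple _ sQ) mulr1.
  rewrite [X in X + _]nth_default ?size_combination // add0r => <-.
  by have /monicP := mf; rewrite lead_coefE szf.
- move=> k; rewrite negb_and -!ltnNge => /orP[/lowE //|lt_uk].
  by rewrite /fourier_coef form_low_degree ?szf ?mul0r.
Qed.

(** * The Jacobi matrix *)

Lemma jacobi_represents (R : realType) (Q : nat -> {poly R}) (J : smatrix R) :
  is_monic_jacobi Q J -> represents J (fun n => 'X * Q n) Q.
Proof.
move=> [C [D [_ rec ->]]] n.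
have far k : ~~ (n.-1 <= k < n.+2)%N -> tridiag C D n k = 0.
  rewrite /tridiag negb_and -leqNgt -ltnNge => out.
  by rewrite !ifF //; apply: contraTF out => /eqP; lia.
apply: expansion_of_band far; apply: etrans (rec n) _.
case: n => [|n] /=.
  rewrite 2?big_ltn // big_geq //.
  by rewrite /tridiag /= scaler0 !addr0 scale1r addrC.
rewrite 3?big_ltn ?big_geq //; last lia.
rewrite /tridiag !eqxx (ltn_eqF (ltnSn n)) (ltn_eqF (leqnSn n.+1)).
by rewrite (gtn_eqF (ltnSn n.+1)) scale1r addr0 [RHS]addrC
  [X in X + _ = _]addrC.
Qed.

(** Self-adjointness of multiplication by t leaves the three terms of the
recurrence.  It also gives C_(n+1) = <Q_(n+1), Q_(n+1)> / <Q_n, Q_n>, since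
t Q_n and Q_(n+1) differ by a polynomial of degree at most n; hence C_(n+1) is
nonzero.  Uniqueness concerns the matrix and not the pair (C, D): no entry of
the matrix is C_0. *)
Lemma jacobi_unique_exists (R : realType) (B : {poly R} -> {poly R} -> R)
    (Q : nat -> {poly R}) :
  symmetric_bilinear B -> quasi_definite B -> monic_orthogonal B Q ->
  (forall f g, B ('X * f) g = B f ('X * g)) ->
  exists! J : smatrix R, is_monic_jacobi Q J.
Proof.
move=> sB qd oQ adjX; have sQ := monic_orthogonal_simple oQ.
have szX n : size ('X * Q n) = n.+2.
  by rewrite mulrC size_mulX -?size_poly_eq0 sQ.2.
have monX n : 'X * Q n \is monic by rewrite monicMl ?monicX ?sQ.1.
have lowX n k : (k < n.-1)%N -> B ('X * Q n) (Q k) = 0.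
  move=> lt_kn; rewrite adjX (form_sym sB) (form_low_degree sB oQ) // szX.
  lia.
have band n := fourier_band sB qd oQ (monX n) (szX n) (lowX n).
pose D n := fourier_coef B Q ('X * Q n) n.
pose C n := fourier_coef B Q ('X * Q n) n.-1.
have jJ : is_monic_jacobi Q (tridiag C D).
  exists C, D; split=> // [[//|n] _|n].
    have -> : C n.+1 = B (Q n.+1) (Q n.+1) / B (Q n) (Q n).
      rewrite /C /fourier_coef /= adjX; congr (_ / _).
      (* Both polynomials are monic of degree n + 1. *)
      have szB : (size ('X * Q n - Q n.+1)%R <= n.+1)%N.
        apply/leq_sizeP => j; rewrite leq_eqVlt => /predU1P[<-|lt_nj].
          rewrite coefB (coef_simple _ sQ) coefXM /= (coef_simple _ sQ).
          by rewrite subrr.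
        by rewrite coefB !nth_default ?subrr ?sQ.2 ?szX.
      rewrite (form_sym sB) -[X in B X _](subrK (Q n.+1)).
      rewrite -[X in B (X + _)]scale1r.
      by rewrite (form_linear sB) (form_low_degree sB oQ szB) mulr0 add0r.
    by rewrite mulf_neq0 ?invr_eq0 // (norm_neq0 _ sB qd oQ).
  have [+ lead _] := band n; rewrite /C /D; move: lead.
  case: n => [|n] /= lead {1}->.
    by rewrite 2?big_ltn // big_geq // lead scaler0 !addr0 scale1r addrC.
  rewrite 3?big_ltn ?big_geq //; last lia.
  by rewrite lead scale1r addr0 [LHS]addrC [X in _ = X + _]addrC.
exists (tridiag C D); split=> // J' jJ'.
exact: represents_inj sQ (jacobi_represents jJ) (jacobi_represents jJ').
Qed.

(** * The band, lower and upper matrices *)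

Lemma recurrence_represents (R : realType) (h : {poly R}) (N : nat)
    (Ps : nat -> {poly R}) (Js : smatrix R) :
  is_recurrence_band h N Ps Js -> represents Js (fun n => h * Ps n) Ps.
Proof. by move=> [e _ out] n; apply: expansion_of_band (e n) _ => k /out. Qed.

Lemma upper_represents (R : realType) (h : {poly R}) (N : nat)
    (P Ps : nat -> {poly R}) (U : smatrix R) :
  is_upper_connection h N P Ps U -> represents U (fun n => h * P n) Ps.
Proof. by move=> [e _ out] n; apply: expansion_of_band (e n) _ => k /out. Qed.

Lemma lower_represents (R : realType) (N : nat) (P Ps : nat -> {poly R})
    (L : smatrix R) :
  is_lower_connection N P Ps L -> represents L Ps P.
Proof.
move=> [e diag out] n.
apply: (@expansion_of_band _ _ _ _ (n - N) n.+1) => [|k /out //].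
by rewrite big_nat_recr ?leq_subr //= diag scale1r addrC.
Qed.

Lemma size_monic_mul (R : realType) (h : {poly R}) (Q : nat -> {poly R})
    (n : nat) :
  h \is monic -> simple_sequence Q ->
  h * Q n \is monic /\ size (h * Q n) = (n + (size h).-1).+1.
Proof.
move=> mh [mQ szQ]; split; first by rewrite monicMl.
rewrite size_monicM ?szQ ?monic_neq0 // -?size_poly_eq0 ?szQ //.
have : size h != 0%N by rewrite size_poly_eq0 monic_neq0.
by case: (size h) => // k _; rewrite addSn addnS addnC.
Qed.

(** Below the band, <h P*_n, P*_k> = <P*_n, h P*_k>, and h P*_k has degree less
than n when k < n - N. *)
Lemma recurrence_unique_exists (R : realType)
    (B : {poly R} -> {poly R} -> R) (h : {poly R}) (Ps : nat -> {poly R}) :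
  symmetric_bilinear B -> quasi_definite B -> monic_orthogonal B Ps ->
  h \is monic -> (forall f g, B (h * f) g = B f (h * g)) ->
  exists! Js : smatrix R, is_recurrence_band h (size h).-1 Ps Js.
Proof.
move=> sB qd oPs mh adjh; have sPs := monic_orthogonal_simple oPs.
have low n k : (k < n - (size h).-1)%N -> B (h * Ps n) (Ps k) = 0.
  move=> lt_k; rewrite adjh (form_sym sB) (form_low_degree sB oPs) //.
  by rewrite (size_monic_mul k mh sPs).2 addnC -ltn_subRL.
have band n := fourier_band sB qd oPs (size_monic_mul n mh sPs).1
                 (size_monic_mul n mh sPs).2 (low n).
have ex : is_recurrence_band h (size h).-1 Ps
            (fun n => fourier_coef B Ps (h * Ps n)).
  by split=> n; have [e lead out] := band n.
exists (fun n => fourier_coef B Ps (h * Ps n)); split=> // Js' eJs'.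
exact: represents_inj sPs (recurrence_represents ex)
                          (recurrence_represents eJs').
Qed.

(** Below the band, (P*_n, P_k)_0 = (P_k, P*_n)_0 = <h P_k, P*_n>, and h P_k has
degree less than n when k < n - N. *)
Lemma lower_unique_exists (R : realType)
    (B B0 : {poly R} -> {poly R} -> R) (h : {poly R})
    (P Ps : nat -> {poly R}) :
  symmetric_bilinear B -> monic_orthogonal B Ps ->
  symmetric_bilinear B0 -> quasi_definite B0 -> monic_orthogonal B0 P ->
  h \is monic -> (forall f g, B (h * f) g = B0 f g) ->
  exists! L : smatrix R, is_lower_connection (size h).-1 P Ps L.
Proof.
move=> sB oPs sB0 qd0 oP mh Bh.
have [sP sPs] := (monic_orthogonal_simple oP, monic_orthogonal_simple oPs).
have low n k : (k < n - (size h).-1)%N -> B0 (Ps n) (P k) = 0.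
  move=> lt_k; rewrite (form_sym sB0) -Bh (form_low_degree sB oPs) //.
  by rewrite (size_monic_mul k mh sP).2 addnC -ltn_subRL.
have band n := fourier_band sB0 qd0 oP (sPs.1 n) (sPs.2 n) (low n).
have ex : is_lower_connection (size h).-1 P Ps
            (fun n => fourier_coef B0 P (Ps n)).
  split=> n; have [e lead out] := band n => //.
  by rewrite {1}e big_nat_recr ?leq_subr //= lead scale1r addrC.
exists (fun n => fourier_coef B0 P (Ps n)); split=> // L' eL'.
exact: represents_inj sP (lower_represents ex) (lower_represents eL').
Qed.

(** Left of the diagonal, <h P_n, P*_k> = (P_n, P*_k)_0, and P*_k has degree
k < n. *)
Lemma upper_unique_exists (R : realType)
    (B B0 : {poly R} -> {poly R} -> R) (h : {poly R})
    (P Ps : nat -> {poly R}) :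
  symmetric_bilinear B -> quasi_definite B -> monic_orthogonal B Ps ->
  symmetric_bilinear B0 -> monic_orthogonal B0 P ->
  h \is monic -> (forall f g, B (h * f) g = B0 f g) ->
  exists! U : smatrix R, is_upper_connection h (size h).-1 P Ps U.
Proof.
move=> sB qd oPs sB0 oP mh Bh.
have [sP sPs] := (monic_orthogonal_simple oP, monic_orthogonal_simple oPs).
have low n k : (k < n)%N -> B (h * P n) (Ps k) = 0.
  by move=> lt_kn; rewrite Bh (form_sym sB0) (form_low_degree sB0 oP) ?sPs.2.
have band n := fourier_band sB qd oPs (size_monic_mul n mh sP).1
                 (size_monic_mul n mh sP).2 (low n).
have ex : is_upper_connection h (size h).-1 P Ps
            (fun n => fourier_coef B Ps (h * P n)).
  by split=> n; have [e lead out] := band n.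
exists (fun n => fourier_coef B Ps (h * P n)); split=> // U' eU'.
exact: represents_inj sPs (upper_represents ex) (upper_represents eU').
Qed.

(** The two sides of each identity represent the same sequence: h P in the basis
P for the first, h P* in the basis P* for the second. *)
Lemma band_factorization (R : realType) (h : {poly R}) (N : nat)
    (P Ps : nat -> {poly R}) (J Js L U : smatrix R) :
  simple_sequence P -> simple_sequence Ps ->
  is_monic_jacobi P J -> is_recurrence_band h N Ps Js ->
  is_lower_connection N P Ps L -> is_upper_connection h N P Ps U ->
  shornermx h J = smulmx U L /\ Js = smulmx L U.
Proof.
move=> sP sPs /jacobi_represents rJ /recurrence_represents rJs.
move=> /lower_represents rL /upper_represents rU; split.
  exact: represents_inj sP (represents_hornermx h rJ) (represents_mul rU rL).
exact: represents_inj sPs rJs (represents_mul (represents_mulpoly h rL) rU).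
Qed.

(** * The Sobolev form and the form of h dmu *)

Definition moment_functional (R : realType)
    (mu : {measure set (measurableTypeR R) -> \bar R}) (p : {poly R}) : R :=
  Rintegral mu setT (fun t : R => p.[t]).

Lemma integrable_poly (R : realType)
    (mu : {measure set (measurableTypeR R) -> \bar R}) (p : {poly R}) :
  finite_moments mu -> mu.-integrable setT (EFin \o (fun t : R => p.[t])).
Proof.
move=> fm.
have -> : EFin \o (fun t : R => p.[t]) =
          fun t : R => (\sum_(i < size p) (p`_i)%:E * (t ^+ i)%:E)%E.
  apply/funext => t /=; rewrite horner_coef -sumEFin.
  by apply: eq_bigr => i _; rewrite EFinM.
by apply: integrable_sum => // i _; apply: integrableZl.
Qed.

Lemma moment_functional_linear (R : realType)
    (mu : {measure set (measurableTypeR R) -> \bar R}) (a : R)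
    (p q : {poly R}) :
  finite_moments mu ->
  moment_functional mu (a *: p + q) =
    a * moment_functional mu p + moment_functional mu q.
Proof.
move=> fm; rewrite /moment_functional -RintegralZl ?integrable_poly //.
rewrite -RintegralD ?integrable_poly //.
  by congr Rintegral; apply/funext => t; rewrite hornerD hornerZ.
have -> : (fun t : R => a * p.[t]) = (fun t : R => (a *: p).[t]).
  by apply/funext => t; rewrite hornerZ.
exact: integrable_poly.
Qed.

Lemma weighted_formE (R : realType)
    (mu : {measure set (measurableTypeR R) -> \bar R}) (h f g : {poly R}) :
  weighted_form mu h f g = moment_functional mu (f * g * h).
Proof. by congr Rintegral; apply/funext => t; rewrite !hornerM. Qed.

Lemma sobolev_formE (R : realType)
    (mu : {measure set (measurableTypeR R) -> \bar R}) (M : nat)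
    (alpha : 'I_M -> R) (m : 'I_M -> nat) (lambda : 'I_M -> nat -> R)
    (f g : {poly R}) :
  sobolev_form mu alpha m lambda f g = moment_functional mu (f * g) +
    \sum_(i < M) \sum_(j < (m i).+1)
       lambda i j * (f^`(j)).[alpha i] * (g^`(j)).[alpha i].
Proof.
by congr (Rintegral _ _ _ + _); apply/funext => t; rewrite !hornerM.
Qed.

Lemma weighted_form_symmetric_bilinear (R : realType)
    (mu : {measure set (measurableTypeR R) -> \bar R}) (h : {poly R}) :
  finite_moments mu -> symmetric_bilinear (weighted_form mu h).
Proof.
move=> fm; split=> [f g|a f1 f2 g]; rewrite !weighted_formE.
  by rewrite (mulrC f).
by rewrite -moment_functional_linear // !mulrDl -!scalerAl.
Qed.

Lemma sobolev_form_symmetric_bilinear (R : realType)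
    (mu : {measure set (measurableTypeR R) -> \bar R}) (M : nat)
    (alpha : 'I_M -> R) (m : 'I_M -> nat) (lambda : 'I_M -> nat -> R) :
  finite_moments mu -> symmetric_bilinear (sobolev_form mu alpha m lambda).
Proof.
move=> fm; split=> [f g|a f1 f2 g]; rewrite !sobolev_formE.
  rewrite (mulrC f); congr (_ + _).
  by apply: eq_bigr => i _; apply: eq_bigr => j _; rewrite mulrAC.
rewrite mulrDl -scalerAl moment_functional_linear // mulrDr addrACA.
congr (_ + _); rewrite mulr_sumr -big_split; apply: eq_bigr => i _ /=.
rewrite mulr_sumr -big_split; apply: eq_bigr => j _ /=.
by rewrite derivnD derivnZ hornerD hornerZ mulrDr mulrDl mulrCA -!mulrA.
Qed.

(** Differentiation lowers the multiplicity of a root by at most one. *)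
Lemma root_derivn_multiple (R : comNzRingType) (q : {poly R}) (a : R)
    (k j : nat) :
  (j < k)%N -> ((('X - a%:P) ^+ k * q)^`(j)).[a] = 0.
Proof.
elim: j k q => [|j IHj] [//|k] q lt_jk.
  by rewrite derivn0 exprS -mulrA hornerM hornerXsubC subrr mul0r.
rewrite derivSn.
have -> : (('X - a%:P) ^+ k.+1 * q)^`() =
          ('X - a%:P) ^+ k * (q *+ k.+1 + ('X - a%:P) * q^`()).
  rewrite derivM deriv_exp derivXsubC mul1r mulrDr mulrnAl mulrnAr mulrA.
  by rewrite -exprSr.
exact: IHj.
Qed.

(** Each derivative in the discrete part is evaluated at a node where h has a
higher order of vanishing, so only the integral survives. *)
Lemma sobolev_node_poly (R : realType)
    (mu : {measure set (measurableTypeR R) -> \bar R}) (M : nat)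
    (alpha : 'I_M -> R) (m : 'I_M -> nat) (lambda : 'I_M -> nat -> R)
    (f g : {poly R}) :
  sobolev_form mu alpha m lambda (node_poly alpha m * f) g =
    weighted_form mu (node_poly alpha m) f g.
Proof.
rewrite sobolev_formE weighted_formE [X in _ + X]big1 ?addr0 => [|i _].
  by rewrite -mulrA mulrC.
rewrite big1 // => j _; rewrite /node_poly (bigD1 i) //=.
by rewrite -[_ ^+ _ * _ * f]mulrA root_derivn_multiple // mulr0 mul0r.
Qed.

Lemma node_poly_monic (R : realType) (M : nat) (alpha : 'I_M -> R)
    (m : 'I_M -> nat) : node_poly alpha m \is monic.
Proof. by apply: monic_prod => i _; rewrite monic_exp ?monicXsubC. Qed.

Theorem theorem2 (R : realType) (mu : probability (measurableTypeR R) R)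
    (mu_nontrivial : nontrivial_measure mu)
    (mu_moments : finite_moments mu)
    (M : nat) (alpha : 'I_M -> R) (alpha_inj : injective alpha)
    (m : 'I_M -> nat) (lambda : 'I_M -> nat -> R)
    (h : {poly R}) (h_def : h = node_poly alpha m)
    (N : nat) (N_def : N = (size h).-1)
    (qd_sobolev : quasi_definite (sobolev_form mu alpha m lambda))
    (qd_mu0 : quasi_definite (weighted_form mu h))
    (Ps P : nat -> {poly R})
    (Ps_orth : monic_orthogonal (sobolev_form mu alpha m lambda) Ps)
    (P_orth : monic_orthogonal (weighted_form mu h) P) :
  [/\ exists! J : smatrix R, is_monic_jacobi P J,
      exists! Js : smatrix R, is_recurrence_band h N Ps Js,
      exists! L : smatrix R, is_lower_connection N P Ps L,
      exists! U : smatrix R, is_upper_connection h N P Ps U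
    & forall J Js L U : smatrix R,
        is_monic_jacobi P J ->
        is_recurrence_band h N Ps Js ->
        is_lower_connection N P Ps L ->
        is_upper_connection h N P Ps U ->
        shornermx h J = smulmx U L /\ Js = smulmx L U].
Proof.
have sB := sobolev_form_symmetric_bilinear alpha m lambda mu_moments.
have sB0 := weighted_form_symmetric_bilinear h mu_moments.
have mh : h \is monic by rewrite h_def node_poly_monic.
have Bh f g : sobolev_form mu alpha m lambda (h * f) g = weighted_form mu h f g.
  by rewrite h_def sobolev_node_poly.
rewrite N_def; split.
- apply: (jacobi_unique_exists sB0 qd_mu0 P_orth _) => f g.
  by rewrite !weighted_formE mulrCA mulrA.
- apply: (recurrence_unique_exists sB qd_sobolev Ps_orth mh _) => f g.
  by rewrite Bh (form_sym sB0) -Bh (form_sym sB).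
- exact: lower_unique_exists sB Ps_orth sB0 qd_mu0 P_orth mh Bh.
- exact: upper_unique_exists sB qd_sobolev Ps_orth sB0 P_orth mh Bh.
- move=> J Js L U; apply: band_factorization.
    exact: monic_orthogonal_simple P_orth.
  exact: monic_orthogonal_simple Ps_orth.
Qed.
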